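(* Let $\mathcal{A}=\{A_0,A_1,A_2\}$ be the standard basis of a symmetric rank $3$ standard integral table algebra with character table $[1,k,\ell;\,1,r,-1-r;\,1,s,-1-s]$, and suppose $k=\ell$ and $s=-1-r$. Then $k=\ell=2(r+r^2)$, and each of the following $11$ partitions of $\{2,\dots,9\}$ gives a fusion of $\mathcal{A}\otimes\mathcal{A}$: $27|34|59|6|8$, $23|47|59|68$, $23|4579|68$, $2359|47|68$, $23|4678|59$, $2347|59|68$, $2368|47|59$, $234678|59$, $234579|68$, $2359|4678$, $2368|4579$.
   Context: A symmetric rank $3$ standard integral table algebra is a commutative associative complex algebra with basis $A_0=1,A_1,A_2$ such that the structure constants $\lambda_{ijh}$ ($A_iA_j=\sum_h\lambda_{ijh}A_h$) are nonnegative reals, $\lambda_{ij0}=0$ for $i\neq j$, and $\lambda_{ii0}=\delta(A_i)$ is a positive integer, where $\delta$ is the valency homomorphism. Main example: $A_0=I_n$, $A_1$ the adjacency matrix of a strongly regular graph, $A_2=J-I-A_1$. Here $k=\delta(A_1)$, $\ell=\delta(A_2)$, and the character table has rows the characters $\chi_0=\delta,\chi_1,\chi_2$ and columns $A_0,A_1,A_2$. The tensor square $\mathcal{A}\otimes\mathcal{A}$ has basis $A_{ij}=A_i\otimes A_j$, relabelled $C_{3j+i+1}=A_{ij}$: $C_1=A_{00},C_2=A_{10},C_3=A_{20},C_4=A_{01},C_5=A_{11},C_6=A_{21},C_7=A_{02},C_8=A_{12},C_9=A_{22}$. Partitions of $\{2,\dots,9\}$ are written with blocks separated by bars. A partition $\tau$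 gives a fusion of $\mathcal{A}\otimes\mathcal{A}$ if the span of $C_1$ and the block sums $\sum_{t\in T}C_t$ ($T$ a block of $\tau$) is closed under multiplication. *)

(* Defs.v *)
From HB Require Import structures.
From mathcomp Require Import all_boot all_order all_algebra all_field.
From mathcomp Require Import reals.
From mathcomp.real_closed Require Import complex.

Set Implicit Arguments.
Unset Strict Implicit.
Unset Printing Implicit Defensive.

Import Order.TTheory GRing.Theory Num.Theory.
Local Open Scope ring_scope.

Set Warnings "-redundant-canonical-projection".

(* The tensor product of two finite-dimensional algebras, in coordinates: the *)
(* (i, j) entry is the coefficient of e_i \ox f_j, for (e_i) and (f_j) the    *)
(* library's bases of A and B. Lemmas tens_linearl, tens_linearr, tensM and   *)
(* tens1 are the algebra rules for \ox, and tens_basis says that              *)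
(* (a_i \ox b_j) is a basis whenever (a_i) and (b_j) are.                     *)
Definition tensalg (F : fieldType) (A B : falgType F) : Type :=
  'M[F]_(\dim {:A}, \dim {:B}).

HB.instance Definition _ (F : fieldType) (A B : falgType F) :=
  Vector.copy (tensalg A B) 'M[F]_(\dim {:A}, \dim {:B}).

Section TensorAlgebra.
Variables (F : fieldType) (A B : falgType F).

Local Notation T := (tensalg A B).
Local Notation e i := ((vbasis {:A})`_i).
Local Notation f j := ((vbasis {:B})`_j).

Definition tens (a : A) (b : B) : T :=
  \matrix_(i, j) (coord (vbasis {:A}) i a * coord (vbasis {:B}) j b).

Definition tens_one : T := tens 1 1.

Definition tens_mul (x y : T) : T :=
  \sum_i \sum_j \sum_k \sum_l
    (x i j * y k l) *: tens (e i * e k) (f j * f l).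

Lemma tens_linearl b : linear (tens^~ b).
Proof. by move=> c a a'; apply/matrixP=> i j; rewrite !mxE linearP mulrDl mulrA. Qed.

Lemma tens_linearr a : linear (tens a).
Proof.
by move=> c b b'; apply/matrixP=> i j; rewrite !mxE linearP mulrDr mulrCA.
Qed.

Lemma tens_mul_linearl y : linear (tens_mul^~ y).
Proof.
move=> c x x'; rewrite /tens_mul scaler_sumr -big_split; apply: eq_bigr => i _.
rewrite /= scaler_sumr -big_split; apply: eq_bigr => j _.
rewrite /= scaler_sumr -big_split; apply: eq_bigr => k _.
rewrite /= scaler_sumr -big_split; apply: eq_bigr => l _.
by rewrite /= !mxE mulrDl scalerDl scalerA mulrA.
Qed.

Lemma tens_mul_linearr x : linear (tens_mul x).
Proof.
move=> c y y'; rewrite /tens_mul scaler_sumr -big_split; apply: eq_bigr => i _.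
rewrite /= scaler_sumr -big_split; apply: eq_bigr => j _.
rewrite /= scaler_sumr -big_split; apply: eq_bigr => k _.
rewrite /= scaler_sumr -big_split; apply: eq_bigr => l _.
by rewrite /= !mxE mulrDr scalerDl scalerA mulrCA.
Qed.

Lemma tens_delta (i : 'I_(\dim {:A})) (j : 'I_(\dim {:B})) :
  tens (e i) (f j) = delta_mx i j.
Proof.
apply/matrixP=> i' j'; rewrite !mxE !coord_free ?(basis_free (vbasisP _)) //.
by rewrite -natrM mulnb (eq_sym i) (eq_sym j).
Qed.

Lemma tens_sum (x : T) : x = \sum_i \sum_j x i j *: tens (e i) (f j).
Proof.
rewrite {1}[x]matrix_sum_delta; apply: eq_bigr => i _; apply: eq_bigr => j _.
by rewrite tens_delta.
Qed.

Lemma tens_mul_delta (i k : 'I_(\dim {:A})) (j l : 'I_(\dim {:B})) :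
  tens_mul (tens (e i) (f j)) (tens (e k) (f l)) = tens (e i * e k) (f j * f l).
Proof.
rewrite !tens_delta /tens_mul.
rewrite (bigD1 i) //= (bigD1 j) //= (bigD1 k) //= (bigD1 l) //= !mxE !eqxx.
rewrite mulr1 scale1r !big1 ?addr0 // => [i' ne|j' ne|k' ne|l' ne].
- rewrite big1 // => j' _; rewrite big1 // => k' _; rewrite big1 // => l' _.
  by rewrite !mxE (negPf ne) mul0r scale0r.
- rewrite big1 // => k' _; rewrite big1 // => l' _.
  by rewrite !mxE (negPf ne) andbF mul0r scale0r.
- by rewrite big1 // => l' _; rewrite !mxE (negPf ne) mulr0 scale0r.
by rewrite !mxE (negPf ne) andbF mulr0 scale0r.
Qed.

Let lin_ext (V W : vectType F) (g h : V -> W) :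
    linear g -> linear h ->
    (forall i : 'I_(\dim {:V}), g (vbasis {:V})`_i = h (vbasis {:V})`_i) ->
  g =1 h.
Proof.
move=> lg lh gh v.
pose g' : {linear V -> W} := HB.pack g (GRing.isLinear.Build F V W _ g lg).
pose h' : {linear V -> W} := HB.pack h (GRing.isLinear.Build F V W _ h lh).
change (g' v = h' v); rewrite (coord_vbasis (memvf v)) !linear_sum.
by apply: eq_bigr => i _; rewrite !linearZ /=; congr (_ *: _); apply: gh.
Qed.

Lemma tens_linext (W : lmodType F) (g h : T -> W) :
  linear g -> linear h -> (forall a b, g (tens a b) = h (tens a b)) -> g =1 h.
Proof.
move=> lg lh gh x.
pose g' : {linear T -> W} := HB.pack g (GRing.isLinear.Build F T W _ g lg).
pose h' : {linear T -> W} := HB.pack h (GRing.isLinear.Build F T W _ h lh).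
change (g' x = h' x); rewrite [x]tens_sum !linear_sum; apply: eq_bigr => i _.
rewrite !linear_sum; apply: eq_bigr => j _.
by rewrite !linearZ /=; congr (_ *: _); apply: gh.
Qed.

Lemma tens_mulE a b c d :
  tens_mul (tens a b) (tens c d) = tens (a * c) (b * d).
Proof.
move: a; apply: lin_ext => [z u v|z u v|i].
- by rewrite tens_linearl tens_mul_linearl.
- by rewrite mulrDl -scalerAl tens_linearl.
move: b; apply: lin_ext => [z u v|z u v|j].
- by rewrite tens_linearr tens_mul_linearl.
- by rewrite mulrDl -scalerAl tens_linearr.
move: c; apply: lin_ext => [z u v|z u v|k].
- by rewrite tens_linearl tens_mul_linearr.
- by rewrite mulrDr -scalerAr tens_linearl.
move: d; apply: lin_ext => [z u v|z u v|l].
- by rewrite tens_linearr tens_mul_linearr.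
- by rewrite mulrDr -scalerAr tens_linearr.
exact: tens_mul_delta.
Qed.

Fact tens_mulA : associative tens_mul.
Proof.
move=> x y z; move: x; apply: tens_linext => [c u v|c u v|a b].
- by rewrite tens_mul_linearl.
- by rewrite !tens_mul_linearl.
move: y; apply: tens_linext => [c u v|c u v|a' b'].
- by rewrite tens_mul_linearl tens_mul_linearr.
- by rewrite tens_mul_linearr tens_mul_linearl.
move: z; apply: tens_linext => [c u v|c u v|a'' b''].
- by rewrite !tens_mul_linearr.
- by rewrite tens_mul_linearr.
by rewrite !tens_mulE !mulrA.
Qed.

Fact tens_mul1l : left_id tens_one tens_mul.
Proof.
apply: tens_linext => [c u v|//|a b]; first by rewrite tens_mul_linearr.
by rewrite tens_mulE !mul1r.
Qed.

Fact tens_mul1r : right_id tens_one tens_mul.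
Proof.
apply: tens_linext => [c u v|//|a b]; first by rewrite tens_mul_linearl.
by rewrite tens_mulE !mulr1.
Qed.

Fact tens_mulDl : left_distributive tens_mul +%R.
Proof.
by move=> x y z; have:= tens_mul_linearl z 1 x y; rewrite !scale1r.
Qed.

Fact tens_mulDr : right_distributive tens_mul +%R.
Proof.
by move=> x y z; have:= tens_mul_linearr x 1 y z; rewrite !scale1r.
Qed.

Fact tens_one_neq0 : tens_one != 0.
Proof.
have nz (V : falgType F) : exists i, coord (vbasis {:V}) i 1 != 0.
  apply/existsP; rewrite -negb_forall; apply/negP => /forallP c0.
  have /eqP[] := oner_neq0 V; rewrite (coord_vbasis (memvf 1)).
  by rewrite big1 // => i _; rewrite (eqP (c0 i)) scale0r.
have [[i nzi] [j nzj]] := (nz A, nz B).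
by apply/eqP => /matrixP/(_ i j)/eqP; rewrite !mxE mulf_eq0 (negPf nzi) (negPf nzj).
Qed.

HB.instance Definition _ := GRing.Zmodule_isNzRing.Build T
  tens_mulA tens_mul1l tens_mul1r tens_mulDl tens_mulDr tens_one_neq0.

Fact tens_scalerAl (c : F) (x y : T) : c *: (x * y) = (c *: x) * y.
Proof.
rewrite -[RHS]/(tens_mul _ _) -[c *: x]addr0 tens_mul_linearl.
by rewrite -[tens_mul 0 y]/(0 * y) mul0r addr0.
Qed.

HB.instance Definition _ := GRing.Lmodule_isLalgebra.Build F T tens_scalerAl.

Fact tens_scalerAr (c : F) (x y : T) : c *: (x * y) = x * (c *: y).
Proof.
rewrite -[RHS]/(tens_mul _ _) -[c *: y]addr0 tens_mul_linearr.
by rewrite -[tens_mul x 0]/(x * 0) mulr0 addr0.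
Qed.

HB.instance Definition _ := GRing.Lalgebra_isAlgebra.Build F T tens_scalerAr.
HB.instance Definition _ := Algebra_isFalgebra.Build F T.

Lemma tens1 : tens 1 1 = 1 :> T.
Proof. by []. Qed.

Lemma tensM a b a' b' : tens a b * tens a' b' = tens (a * a') (b * b').
Proof. exact: tens_mulE. Qed.

Lemma tens_basis m n (X : m.-tuple A) (Y : n.-tuple B) :
  basis_of {:A} X -> basis_of {:B} Y ->
  basis_of {:T} [seq tens a b | a <- X, b <- Y].
Proof.
move=> bX bY; rewrite basisEdim; apply/andP; split; last first.
  rewrite size_allpairs !size_tuple -(size_basis bX) -(size_basis bY).
  by rewrite [X in (_ <= X)%N]dimvf.
apply/subvP=> x _; rewrite [x]tens_sum.
apply: memv_suml => i _; apply: memv_suml => j _; apply: memvZ.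
move: (e i) (f j) => a b; rewrite (coord_basis bX (memvf a)).
pose ga : {linear A -> T} := HB.pack (tens^~ b)
  (GRing.isLinear.Build F A T _ (tens^~ b) (tens_linearl b)).
rewrite -[tens _ _]/(ga _) linear_sum; apply: memv_suml => k _.
rewrite linearZ; apply: memvZ; rewrite /= (coord_basis bY (memvf b)).
pose gb : {linear B -> T} := HB.pack (tens X`_k)
  (GRing.isLinear.Build F B T _ (tens X`_k) (tens_linearr X`_k)).
rewrite -[tens _ _]/(gb _) linear_sum; apply: memv_suml => l _.
rewrite linearZ; apply/memvZ/memv_span/allpairsP; exists (X`_k, Y`_l).
by rewrite !mem_nth ?size_tuple.
Qed.

End TensorAlgebra.

(* lambda_ijh: the coefficient of A_h in A_i A_j. *)
Definition struct_const (F : fieldType) (A : falgType F) (b : 3.-tuple A)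
    (i j h : 'I_3) : F :=
  coord b h (b`_i * b`_j).

Record sym_table_algebra3 (R : realType) (A : falgType R[i])
    (b : 3.-tuple A) (delta : 'AHom(A, R[i]^o)) : Prop := SymTableAlgebra3 {
  sta_commutative : commutative (@GRing.mul A);
  sta_basis : basis_of {:A} b;
  sta_one : b`_0 = 1;
  (* In the order of R[i], 0 <= z means that z is real and nonnegative. *)
  sta_ge0 : forall i j h, 0 <= struct_const b i j h;
  sta_ortho : forall i j, i != j -> struct_const b i j ord0 = 0;
  sta_valency : forall i, struct_const b i i ord0 = delta b`_i;
  sta_integral : forall i : 'I_3, exists2 n : nat, (0 < n)%N & delta b`_i = n%:R
}.

(* P is the character table of A with respect to b: its rows list, without    *)
(* repetition, all the irreducible characters of A -- the algebra morphisms   *)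
(* to the field of complex numbers, as A is commutative -- with delta first.  *)
Definition is_character_table (R : realType) (A : falgType R[i])
    (b : 3.-tuple A) (delta : 'AHom(A, R[i]^o)) (P : 'M[R[i]]_3) : Prop :=
  exists chi : 'I_3 -> 'AHom(A, R[i]^o),
    [/\ chi ord0 = delta,
        injective chi,
        forall psi : 'AHom(A, R[i]^o), exists i, psi = chi i &
        P = \matrix_(i, j) chi i b`_j].

(* C_t = A_i \ox A_j for t = 3 * j + i + 1. *)
Definition tens_square_elt (F : fieldType) (A : falgType F) (b : 3.-tuple A)
    (t : nat) : tensalg A A :=
  tens b`_(t.-1 %% 3) b`_(t.-1 %/ 3).

Definition is_partition29 (tau : seq (seq nat)) : bool :=
  ([::] \notin tau) && perm_eq (flatten tau) (iota 2 8).

Definition gives_fusion (F : fieldType) (A : falgType F) (b : 3.-tuple A)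
    (tau : seq (seq nat)) : Prop :=
  let C := tens_square_elt b in
  let gens := C 1%N :: [seq \sum_(t <- T) C t | T <- tau] in
  let U := <<gens>>%VS in
  is_partition29 tau /\ {in U &, forall x y, x * y \in U}.

Definition fusion_partitions : seq (seq (seq nat)) :=
  [:: [:: [:: 2; 7]; [:: 3; 4]; [:: 5; 9]; [:: 6]; [:: 8]];
      [:: [:: 2; 3]; [:: 4; 7]; [:: 5; 9]; [:: 6; 8]];
      [:: [:: 2; 3]; [:: 4; 5; 7; 9]; [:: 6; 8]];
      [:: [:: 2; 3; 5; 9]; [:: 4; 7]; [:: 6; 8]];
      [:: [:: 2; 3]; [:: 4; 6; 7; 8]; [:: 5; 9]];
      [:: [:: 2; 3; 4; 7]; [:: 5; 9]; [:: 6; 8]];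
      [:: [:: 2; 3; 6; 8]; [:: 4; 7]; [:: 5; 9]];
      [:: [:: 2; 3; 4; 6; 7; 8]; [:: 5; 9]];
      [:: [:: 2; 3; 4; 5; 7; 9]; [:: 6; 8]];
      [:: [:: 2; 3; 5; 9]; [:: 4; 6; 7; 8]];
      [:: [:: 2; 3; 6; 8]; [:: 4; 5; 7; 9]]]%N.

Definition mx_of_rows (F : pzRingType) (n : nat) (rows : seq (seq F)) : 'M[F]_n :=
  \matrix_(i, j) nth 0 (nth [::] rows i) j.

(* Main.v *)
Require Import Defs.
From mathcomp Require Import all_boot all_order all_algebra all_field.
From mathcomp Require Import reals.
From mathcomp.real_closed Require Import complex.
From mathcomp Require Import ring.

Set Implicit Arguments.
Unset Strict Implicit.
Unset Printing Implicit Defensive.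

Import Order.TTheory GRing.Theory Num.Theory.
Local Open Scope ring_scope.

(* Evaluating the three characters on A_i A_j determines all the structure    *)
(* constants: with q = r + r^2 - 1,                                           *)
(*   A_1^2 = (2 + 2q) + q A_1 + (1 + q) A_2,                                  *)
(*   A_1 A_2 = (1 + q) A_1 + (1 + q) A_2,                                     *)
(*   A_2^2 = (2 + 2q) + (1 + q) A_1 + q A_2.                                  *)
(* The structure constants of the tensor square are therefore polynomials in  *)
(* q with natural number coefficients, and a partition gives a fusion as soon *)
(* as the products of its block sums have coefficients that are constant on   *)
(* the blocks, as polynomials in q; this is a finite computation.             *)

(** Since s = -1-r, the characters chi_1 and chi_2 differ by exchanging their values r and s at A_1
    and A_2. For i, j > 0 the A_0-coefficient of A_i A_j is known from orthogonality and valency;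
    delta then gives the sum of the other two coefficients, and chi_1 - chi_2 their difference
    ([struct_const_solve]). Evaluating chi_1 on A_1 A_2 yields k. For the fusions,
    [gives_fusion_const_on_blocks] reduces closure to constancy of coefficients on blocks, and
    [fusion_partitions_const] checks this for each power of q separately, hence for all q at
    once. *)

Lemma span_mul_closed (F : fieldType) (A : falgType F) (X : seq A)
    (U : {vspace A}) :
  {in X &, forall x y, x * y \in U} -> {in <<X>>%VS &, forall x y, x * y \in U}.
Proof.
move=> XU x y Xx Xy.
rewrite (coord_span (X := in_tuple X) Xx) (coord_span (X := in_tuple X) Xy).
rewrite mulr_suml; apply: memv_suml => i _.
rewrite mulr_sumr; apply: memv_suml => j _.
by rewrite -scalerAl -scalerAr !memvZ // XU ?mem_nth.
Qed.

(** A combination of the C_v whose coefficients are constant on blocks is a combination of block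
    sums. [B] ranges over [tau] alone because constancy on the singleton block of C_1 is
    automatic. *)
Lemma gives_fusion_const_on_blocks (F : fieldType) (A : falgType F)
    (b : 3.-tuple A) (mu : nat -> nat -> nat -> F) (tau : seq (seq nat)) :
  let C := tens_square_elt b in
  (forall t u, t \in iota 1 9 -> u \in iota 1 9 ->
     C t * C u = \sum_(v <- iota 1 9) mu t u v *: C v) ->
  is_partition29 tau ->
  (forall T S B, T \in [:: 1%N] :: tau -> S \in [:: 1%N] :: tau -> B \in tau ->
    {in B &, forall v w, \sum_(t <- T) \sum_(u <- S) mu t u v
                       = \sum_(t <- T) \sum_(u <- S) mu t u w}) ->
  gives_fusion b tau.
Proof.
move=> C mulC ptau const_mu; split=> //.
have /andP[_ perm_tau] := ptau.
rewrite -/C; set gens := _ :: _; set U := <<gens>>%VS.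
have gensE : gens = [seq \sum_(t <- T) C t | T <- [:: 1%N] :: tau].
  by rewrite /gens /= big_seq1.
have iota19 : iota 1 9 = 1%N :: iota 2 8 by [].
have sub19 T : T \in [:: 1%N] :: tau -> {subset T <= iota 1 9}.
  rewrite inE => /predU1P[-> t|Ttau t tT]; first by rewrite inE => /eqP->.
  rewrite iota19 in_cons -(perm_mem perm_tau).
  by apply/orP; right; apply/flattenP; exists T.
have blockU B : B \in tau -> \sum_(t <- B) C t \in U.
  move=> Btau; apply: memv_span; rewrite gensE.
  by apply: (map_f (fun T => \sum_(t <- T) C t)); rewrite inE Btau orbT.
have const_U (c : nat -> F) :
    (forall B, B \in tau -> {in B &, forall v w, c v = c w}) ->
  \sum_(v <- iota 1 9) c v *: C v \in U.
  move=> const_c; rewrite iota19 big_cons.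
  apply: memvD; first by apply/memvZ/memv_span/mem_head.
  rewrite -(perm_big _ perm_tau) big_flatten big_seq /=.
  apply: memv_suml => -[|v B] vBtau; first by rewrite big_nil mem0v.
  rewrite big_seq (eq_bigr (fun w => c v *: C w)) => [|w wB].
    by rewrite -big_seq -scaler_sumr; apply/memvZ/blockU.
  by rewrite (const_c _ vBtau _ v) ?mem_head.
apply: span_mul_closed; rewrite gensE => _ _ /mapP[T Ttau ->] /mapP[S Stau ->].
rewrite mulr_suml.
have -> : \sum_(t <- T) C t * (\sum_(u <- S) C u) =
    \sum_(v <- iota 1 9) (\sum_(t <- T) \sum_(u <- S) mu t u v) *: C v.
  under [RHS]eq_bigr do rewrite scaler_suml.
  rewrite [RHS]exchange_big [LHS]big_seq [RHS]big_seq; apply: eq_bigr => t tT.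
  under [RHS]eq_bigr do rewrite scaler_suml.
  rewrite [RHS]exchange_big mulr_sumr [LHS]big_seq [RHS]big_seq.
  by apply: eq_bigr => u uS; apply: mulC; [apply: (sub19 T) | apply: (sub19 S)].
by apply: const_U => B Btau v w; apply: const_mu.
Qed.

(* The coefficient of q^e in lambda_ijh; missing entries count as 0. *)
Definition lam_coef (e i j h : nat) : nat :=
  let one := [:: 1] in let q := [:: 0; 1] in
  let q1 := [:: 1; 1] in let dq1 := [:: 2; 2] in
  let rows := [:: [:: [:: one];            [:: [::]; one];    [:: [::]; [::]; one]];
                  [:: [:: [::]; one];      [:: dq1; q; q1];   [:: [::]; q1; q1]];
                  [:: [:: [::]; [::]; one]; [:: [::]; q1; q1]; [:: dq1; q1; q]]] in
  nth 0 (nth [::] (nth [::] (nth [::] rows i) j) h) e.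

Definition lam (F : pzRingType) (q : F) (i j h : nat) : F :=
  (lam_coef 0 i j h)%:R + (lam_coef 1 i j h)%:R * q.

(* The coefficient of q^e in the coefficient of C_v in C_t C_u. *)
Definition mu_coef (e t u v : nat) : nat :=
  sumn [seq lam_coef a (t.-1 %% 3) (u.-1 %% 3) (v.-1 %% 3)
            * lam_coef (e - a) (t.-1 %/ 3) (u.-1 %/ 3) (v.-1 %/ 3)
       | a <- iota 0 e.+1]%N.

Definition block_coef (e : nat) (T S : seq nat) (v : nat) : nat :=
  sumn [seq sumn [seq mu_coef e t u v | u <- S] | t <- T].

Definition mu (F : comPzRingType) (q : F) (t u v : nat) : F :=
  \sum_(e <- iota 0 3) (mu_coef e t u v)%:R * q ^+ e.

Definition const_on_blocks (tau : seq (seq nat)) : bool :=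
  all (fun e => all (fun T => all (fun S => all (fun B =>
    constant [seq block_coef e T S v | v <- B]) tau)
  ([:: 1] :: tau)) ([:: 1] :: tau)) (iota 0 3).

Lemma fusion_partitions_const :
  all (fun tau => is_partition29 tau && const_on_blocks tau) fusion_partitions.
Proof. by vm_compute. Qed.

Lemma sum_mu (F : comPzRingType) (q : F) (T S : seq nat) (v : nat) :
  \sum_(t <- T) \sum_(u <- S) mu q t u v
    = \sum_(e <- iota 0 3) (block_coef e T S v)%:R * q ^+ e.
Proof.
rewrite /mu; under eq_bigr do rewrite exchange_big.
rewrite exchange_big; apply: eq_bigr => e _.
rewrite /block_coef sumnE big_map natr_sum mulr_suml; apply: eq_bigr => t _.
by rewrite sumnE big_map natr_sum mulr_suml.
Qed.

Lemma lam_mul (F : comPzRingType) (q : F) (t u v : nat) :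
  lam q (t.-1 %% 3) (u.-1 %% 3) (v.-1 %% 3)
    * lam q (t.-1 %/ 3) (u.-1 %/ 3) (v.-1 %/ 3) = mu q t u v.
Proof.
(* Each factor is affine in q, so the q^2 term of the Cauchy product reduces to the product of the
   two linear coefficients. *)
have lam2 i j h : lam_coef 2 i j h = 0%N.
  rewrite /lam_coef.
  by case: i j h => [|[|[|i]]] [|[|[|j]]] [|[|[|h]]] /=; rewrite ?nth_nil.
rewrite /mu /lam /mu_coef !big_cons big_nil /= !subn0 !lam2 /= !subnn.
rewrite -[(2 - 1)%N]/1%N.
by rewrite !natrD !natrM; ring.
Qed.

Lemma tens_square_mul (F : fieldType) (A : falgType F) (b : 3.-tuple A) (q : F) :
  (forall i j : 'I_3, b`_i * b`_j = \sum_(h < 3) lam q i j h *: b`_h) ->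
  forall t u, t \in iota 1 9 -> u \in iota 1 9 ->
  tens_square_elt b t * tens_square_elt b u
    = \sum_(v <- iota 1 9) mu q t u v *: tens_square_elt b v.
Proof.
move=> mulb t u t19 u19.
have bound w : w \in iota 1 9 -> (w.-1 %% 3 < 3)%N /\ (w.-1 %/ 3 < 3)%N.
  by rewrite mem_iota ltn_mod ltn_divLR //; case: w.
have [[ti tj] [ui uj]] := (bound t t19, bound u u19).
rewrite /tens_square_elt tensM.
have tensZl c x y : tens (c *: x) y = c *: tens x y :> tensalg A A.
  by apply/matrixP => i j; rewrite !mxE linearZ mulrA.
have tensZr c x y : tens x (c *: y) = c *: tens x y :> tensalg A A.
  by apply/matrixP => i j; rewrite !mxE linearZ mulrCA.
have tensDl x x' y : tens (x + x') y = tens x y + tens x' y :> tensalg A A.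
  by apply/matrixP => i j; rewrite !mxE linearD mulrDl.
have tensDr x y y' : tens x (y + y') = tens x y + tens x y' :> tensalg A A.
  by apply/matrixP => i j; rewrite !mxE linearD mulrDr.
under eq_bigr do rewrite -lam_mul.
have mulb3 i j : (i < 3)%N -> (j < 3)%N -> b`_i * b`_j =
    lam q i j 0 *: b`_0 + lam q i j 1 *: b`_1 + lam q i j 2 *: b`_2.
  move=> i3 j3; rewrite (mulb (Ordinal i3) (Ordinal j3)).
  by rewrite !big_ord_recr big_ord0 /= add0r.
rewrite (mulb3 _ _ tj uj) !tensDr (mulb3 _ _ ti ui) !tensDl !tensZl !tensZr.
by rewrite !scalerA !big_cons big_nil /= addr0 -!addrA.
Qed.

Lemma constant_in (T : eqType) (s : seq T) :
  constant s -> {in s &, forall x y, x = y}.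
Proof.
case: s => // x s /allP sx y z; rewrite !inE.
by move=> /predU1P[->|/sx/eqP->] /predU1P[->|/sx/eqP->].
Qed.

Lemma gives_fusion_lam (F : fieldType) (A : falgType F) (b : 3.-tuple A) (q : F) :
  (forall i j : 'I_3, b`_i * b`_j = \sum_(h < 3) lam q i j h *: b`_h) ->
  forall tau, tau \in fusion_partitions -> gives_fusion b tau.
Proof.
move=> mulb tau /(allP fusion_partitions_const)/andP[ptau /allP const_tau].
apply: (gives_fusion_const_on_blocks (tens_square_mul mulb)) => // T S B.
move=> Ttau Stau Btau v w Bv Bw; rewrite !sum_mu !big_seq.
apply: eq_bigr => e e3; congr (_%:R * _).
move: (const_tau e e3) => /allP/(_ T Ttau)/allP/(_ S Stau)/allP/(_ B Btau).
by move/constant_in; apply; apply: map_f.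
Qed.

Lemma struct_const_solve (F : numFieldType) (k r s c0 c1 c2 a d : F) :
  k != 0 -> r != s ->
  c0 + c1 * k + c2 * k = c0 + a * k ->
  (c0 + c1 * r + c2 * s) - (c0 + c1 * s + c2 * r) = d * (r - s) ->
  c1 = (a + d) / 2 /\ c2 = (a - d) / 2.
Proof.
move=> k0 rs ea ed.
have sum_c : c1 + c2 = a.
  by apply: (mulIf k0); apply: (addrI c0); rewrite -ea; ring.
have diff_c : c1 - c2 = d.
  by apply: (mulIf (x := r - s)); rewrite ?subr_eq0 // -ed; ring.
by rewrite -sum_c -diff_c; split; field.
Qed.

Theorem theorem4p3 (R : realType) (A : falgType R[i]) (b : 3.-tuple A)
    (delta : 'AHom(A, R[i]^o)) (k l r s : R[i])
    (hA : sym_table_algebra3 b delta)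
    (hP : is_character_table b delta
            (mx_of_rows 3 [:: [:: 1; k; l];
                              [:: 1; r; - 1 - r];
                              [:: 1; s; - 1 - s]]))
    (hkl : k = l) (hs : s = - 1 - r) :
  [/\ k = 2 * (r + r ^+ 2),
      l = 2 * (r + r ^+ 2) &
      forall tau, tau \in fusion_partitions -> gives_fusion b tau].
Proof.
subst l s; case: hA => comm basis_b b0 _ ortho valency integral.
case: hP => chi [chi0 chi_inj _ chiP].
have chi_b (i j : 'I_3) : chi i b`_j = nth 0 (nth [::] [:: [:: 1; k; k];
    [:: 1; r; - 1 - r]; [:: 1; - 1 - r; - 1 - (- 1 - r)]] i) j.
  by have /matrixP/(_ i j) := chiP; rewrite !mxE => <-.
pose o1 : 'I_3 := Ordinal (isT : (1 < 3)%N).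
pose o2 : 'I_3 := Ordinal (isT : (2 < 3)%N).
have [] := (chi_b ord0 o1, chi_b ord0 o2); rewrite /= => c01 c02.
have [] := (chi_b o1 o1, chi_b o1 o2); rewrite /= => c11 c12.
have [] := (chi_b o2 o1, chi_b o2 o2); rewrite /= => c21 c22.
have k_neq0 : k != 0.
  have [n n_gt0 dn] := integral o1.
  by rewrite -c01 chi0 dn pnatr_eq0 -lt0n.
have mulE (i j : 'I_3) : b`_i * b`_j = struct_const b i j ord0 *: 1
    + struct_const b i j o1 *: b`_1 + struct_const b i j o2 *: b`_2.
  rewrite {1}(coord_basis basis_b (memvf (b`_i * b`_j))).
  rewrite !big_ord_recr big_ord0 /= add0r -b0 /struct_const.
  by congr (_ *: _ + _ *: _ + _ *: _); congr (coord b _ _); apply: val_inj.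
have chi_mul m (i j : 'I_3) : chi m b`_i * chi m b`_j = struct_const b i j ord0
    + struct_const b i j o1 * chi m b`_1 + struct_const b i j o2 * chi m b`_2.
  rewrite -rmorphM /= mulE !linearD !linearZ /= rmorph1.
  by rewrite /GRing.scale /= mulr1.
(* Otherwise chi_1 and chi_2 would agree on the basis, against injectivity of [chi]. *)
have r_neq : r != - 1 - r.
  apply/eqP => rE; suff /(congr1 val) : o1 = o2 by [].
  apply: chi_inj; apply: val_inj; apply/lfunP => x.
  rewrite (coord_basis basis_b (memvf x)) !linear_sum; apply: eq_bigr => i _.
  rewrite !linearZ; congr (_ *: _); rewrite /= !chi_b.
  by case: i => [[|[|[|//]]] ?] //=; rewrite -!rE.
have sc_solve (i j : 'I_3) a d := struct_const_solve (c0 := struct_const b i j ord0)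
  (c1 := struct_const b i j o1) (c2 := struct_const b i j o2)
  (a := a) (d := d) k_neq0 r_neq.
have sK : - 1 - (- 1 - r) = r by ring.
have chi_mulE (i j : 'I_3) : [/\
    chi ord0 b`_i * chi ord0 b`_j = struct_const b i j ord0
      + struct_const b i j o1 * k + struct_const b i j o2 * k,
    chi o1 b`_i * chi o1 b`_j = struct_const b i j ord0
      + struct_const b i j o1 * r + struct_const b i j o2 * (- 1 - r) &
    chi o2 b`_i * chi o2 b`_j = struct_const b i j ord0
      + struct_const b i j o1 * (- 1 - r) + struct_const b i j o2 * r].
  by rewrite !chi_mul c01 c02 c11 c12 c21 c22 sK.
have valk (i : 'I_3) : (0 < i)%N -> struct_const b i i ord0 = k.
  by rewrite valency -chi0 chi_b; case: i => [[|[|[]]]].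
have [e0 e1 e2] := chi_mulE o1 o1; rewrite /= c01 c11 c21 in e0 e1 e2.
(* k^2 = k + (c1 + c2) k gives c1 + c2 = k - 1, and r^2 - s^2 = (r + s)(r - s) with r + s = -1 gives
   c1 - c2 = -1. *)
have [|| x1 x2] := sc_solve o1 o1 (k - 1) (- 1).
- by rewrite -e0 valk //; ring.
- by rewrite -e1 -e2; ring.
have [{}e0 {}e1 {}e2] := chi_mulE o1 o2; rewrite /= c01 c02 c11 c12 c21 c22 in e0 e1 e2.
have [|| y1 y2] := sc_solve o1 o2 k 0.
- by rewrite -e0 ortho //; ring.
- by rewrite -e1 -e2; ring.
(* Here chi_1 reads r s = (k/2)(r + s) = -k/2. *)
have kE : k = 2 * (r + r ^+ 2).
  move: e1; rewrite y1 y2 ortho // => e1.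
  have -> : r + r ^+ 2 = - (r * (-1 - r)) by ring.
  by rewrite e1; field.
have [{}e0 {}e1 {}e2] := chi_mulE o2 o2; rewrite /= c02 c12 c22 in e0 e1 e2.
have [|| z1 z2] := sc_solve o2 o2 (k - 1) 1.
- by rewrite -e0 valk //; ring.
- by rewrite -e1 -e2; ring.
(* This q is k/2 - 1, the coefficient of A_1 in A_1^2. *)
split=> //; apply: (gives_fusion_lam (q := r + r ^+ 2 - 1)) => i j.
have xx := mulE o1 o1; rewrite valk // x1 x2 kE /= in xx.
have xy := mulE o1 o2; rewrite ortho // y1 y2 kE /= in xy.
have yy := mulE o2 o2; rewrite valk // z1 z2 kE /= in yy.
rewrite !big_ord_recr big_ord0 /= add0r.
case: i j => [[|[|[|//]]] ?] [[|[|[|//]]] ?] /=;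
  rewrite ?b0 ?mul1r ?mulr1 /lam /lam_coef /=;
  do ?[by rewrite !mul0r !addr0 !scale0r scale1r ?add0r ?addr0];
  rewrite ?[b`_2 * b`_1]comm ?xx ?xy ?yy;
  congr (_ *: _ + _ *: _ + _ *: _); by field.
Qed.
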